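(* Thompson's group $F$ does not have the Liouville property.
   Context: Thompson's group $F$ is the group (under composition) of all continuous piecewise linear transformations (homeomorphisms) of $[0,1]$ whose points of non-differentiability belong to the set of dyadic numbers and whose derivative, where it exists, is an integer power of $2$. For a group $G$ equipped with a probability measure $\mu$, the right random walk on $(G,\mu)$ is the Markov chain $Z$ with state space $G$ and transition probabilities $\mathbb{P}(Z_{n+1}=g\mid Z_n=h)=\mu(h^{-1}g)$, started at the group identity. The Poisson boundary of $(G,\mu)$ is the space of ergodic components of the time shift on the space of trajectories with the law of this walk. A function $f:G\to\mathbb{R}$ is $\mu$-harmonic if $f(g)=\sum_{h\in G}\mu(h)f(gh)$ for all $g\in G$. The pair $(G,\mu)$ is said to have the Liouville property if its Poisson boundary is trivial, or, equivalently, if the space of bounded $\mu$-harmonic functions on $G$ is 1-dimensional, i.e. consists of constant functions. A group $G$ has the Liouville property if and only if the pair $(G,\mu)$ has the Liouville property for every symmetric, finitely supported probability measure $\mu$ on $G$. *)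

(* Defs.v *)
From HB Require Import structures.
From mathcomp Require Import all_boot all_order all_algebra.
From mathcomp Require Import all_classical all_reals all_analysis.
From mathcomp Require Import ring lra.

Set Implicit Arguments.
Unset Strict Implicit.
Unset Printing Implicit Defensive.

Import Order.TTheory GRing.Theory Num.Theory.
Import numFieldNormedType.Exports.

Local Open Scope classical_set_scope.
Local Open Scope ring_scope.

Section ThompsonPredicate.
Variable R : realType.
Implicit Types (f g : R -> R) (s t : seq R).

Definition dyadic (x : R) : Prop :=
  exists (m : int) (n : nat), x = m%:~R / 2 ^+ n.

Definition piecewise_affine f : Prop :=
  exists s : seq R, forall a b : R, 0 <= a -> a < b -> b <= 1 ->
    {in s, forall x, ~~ (a < x < b)} ->
    exists m c : R, {in `[a, b], forall x, f x = m * x + c}.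

(* A self-map of [0, 1] is encoded as a map R -> R that is the identity
   off [0, 1], so that equality of maps is equality of the encodings. *)
Record is_thompson f : Prop := IsThompson {
  thompson_off : forall x : R, x \notin `[0, 1] -> f x = x;
  thompson_continuous : {within `[0, 1], continuous f};
  thompson_bij : set_bij `[0, 1] `[0, 1] f;
  thompson_affine : piecewise_affine f;
  thompson_break : forall x : R, 0 < x < 1 -> ~ derivable f x 1 -> dyadic x;
  thompson_slope : forall x : R, 0 < x < 1 -> derivable f x 1 ->
    exists k : int, derive1 f x = 2 ^ k }.

(* The explicit form of the elements of F, easier to compute with;
   see is_thompsonP. *)
Definition dyadic_pieces f : Prop :=
  exists s : seq R, {in s, forall x, dyadic x} /\
    forall a b : R, 0 <= a -> a < b -> b <= 1 ->
      {in s, forall x, ~~ (a < x < b)} ->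
      exists k : int, forall x, a <= x <= b -> f x = f a + 2 ^ k * (x - a).

Record thompson_core f : Prop := ThompsonCore {
  core_off : forall x : R, x \notin `[0, 1] -> f x = x;
  core_mono : {mono f : x y / x <= y};
  core_surj : forall y, exists x, f x = y;
  core_pieces : dyadic_pieces f }.

Lemma derive1_right f x b m : x < b -> derivable f x 1 ->
  (forall y, x <= y <= b -> f y = f x + m * (y - x)) -> derive1 f x = m.
Proof.
move=> xb df fE; rewrite derive1E; set l := 'D_1 f x.
have Hl : h^-1 *: (f (h *: 1 + x) - f x) @[h --> (0:R)^'] --> l by exact: df.
have Hr : h^-1 *: (f (h *: 1 + x) - f x) @[h --> (0:R)^'+] --> l.
  exact: cvg_dnbhs_at_right.
have Hm : h^-1 *: (f (h *: 1 + x) - f x) @[h --> (0:R)^'+] --> m.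
  apply: cvg_near_cst.
  near=> h.
  have h0 : 0 < h by near: h; exact: nbhs_right_gt.
  have hb : h < b - x by near: h; apply: nbhs_right_lt; lra.
  rewrite /GRing.scale /= mulr1 fE; last by lra.
  by field; rewrite gt_eqF.
exact: (cvg_unique _ Hr Hm).
Unshelve. all: by end_near. Qed.

Lemma derive1_left f x a m : a < x -> derivable f x 1 ->
  (forall y, a <= y <= x -> f y = f x + m * (y - x)) -> derive1 f x = m.
Proof.
move=> ax df fE; rewrite derive1E; set l := 'D_1 f x.
have Hl : h^-1 *: (f (h *: 1 + x) - f x) @[h --> (0:R)^'] --> l by exact: df.
have Hr : h^-1 *: (f (h *: 1 + x) - f x) @[h --> (0:R)^'-] --> l.
  exact: cvg_dnbhs_at_left.
have Hm : h^-1 *: (f (h *: 1 + x) - f x) @[h --> (0:R)^'-] --> m.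
  apply: cvg_near_cst.
  near=> h.
  have h0 : h < 0 by near: h; exact: nbhs_left_lt.
  have hb : a - x < h by near: h; apply: nbhs_left_gt; lra.
  rewrite /GRing.scale /= mulr1 fE; last by lra.
  by field; rewrite lt_eqF.
exact: (cvg_unique _ Hr Hm).
Unshelve. all: by end_near. Qed.

Lemma affine_is_derive f a b x m : a < x < b ->
  (forall y, a <= y <= b -> f y = f a + m * (y - a)) -> is_derive x 1 f m.
Proof.
move=> /andP[ax xb] fE.
apply: (@near_eq_is_derive _ _ _ (fun y => (f a - m * a) + m *: y)).
  near=> y.
  have ay : a < y by near: y; exact: lt_nbhsr.
  have yb : y < b by near: y; exact: lt_nbhsl.
  rewrite (fE y); last by lra.
  by rewrite /GRing.scale /=; ring.
apply: is_derive_eq; rewrite add0r /GRing.scale /= mulr1 mul1r.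
Unshelve. all: by end_near. Qed.

Lemma near_points s x : 0 < x < 1 -> exists a b : R,
  [/\ 0 <= a, a < x, x < b, b <= 1 &
      {in s, forall y, (a < y < b) -> y = x}].
Proof.
move=> x01; elim: s => [|y s [a [b [a0 ax xb b1 H]]]].
  by exists 0, 1; split => //; lra.
have [xy|yx|xy] := ltgtP x y.
- exists a, (Num.min b y); split => //.
  + by rewrite lt_min xb xy.
  + by rewrite ge_min b1.
  move=> z; rewrite inE lt_min => /orP[/eqP ->|zs] /andP[az /andP[zb zy]].
    by rewrite ltxx in zy.
  by apply: H => //; rewrite az zb.
- exists (Num.max a y), b; split => //.
  + by rewrite le_max a0.
  + by rewrite gt_max ax yx.
  move=> z; rewrite inE gt_max => /orP[/eqP ->|zs] /andP[/andP[az yz] zb].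
    by rewrite ltxx in yz.
  by apply: H => //; rewrite az zb.
- exists a, b; split => // z; rewrite inE => /orP[/eqP -> //|zs]; exact: H.
Qed.

Lemma set01E (x : R) : `[0, 1]%classic x = (x \in `[0, 1]) :> Prop.
Proof. by []. Qed.

(* Breakpoints at which f is in fact derivable can be discarded. *)
Lemma pieces_filter f s t :
  (forall a b : R, 0 <= a -> a < b -> b <= 1 ->
    {in s ++ t, forall x, ~~ (a < x < b)} ->
    exists m : R, forall x, a <= x <= b -> f x = f a + m * (x - a)) ->
  {in t, forall x, 0 < x < 1 -> derivable f x 1} ->
  forall a b : R, 0 <= a -> a < b -> b <= 1 ->
    {in s, forall x, ~~ (a < x < b)} ->
    exists m : R, forall x, a <= x <= b -> f x = f a + m * (x - a).
Proof.
elim: t => [|p t IH]; first by rewrite cats0.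
move=> H dt; apply: IH => [|x xt]; last by apply: dt; rewrite inE xt orbT.
move=> a b a0 ab b1 Hst.
have Hsub c d : a <= c -> c < d -> d <= b -> ~~ (c < p < d) ->
  exists m : R, forall x, c <= x <= d -> f x = f c + m * (x - c).
  move=> ac cd db pcd.
  have Hcd x : ~~ (a < x < b) -> ~~ (c < x < d).
    apply: contra => /andP[cx xd].
    by rewrite (le_lt_trans ac)// (lt_le_trans xd).
  apply: H; [lra|done|lra|].
  move=> x; rewrite mem_cat inE => /or3P[xs|/eqP -> //|xt].
    by apply/Hcd/Hst; rewrite mem_cat xs.
  by apply/Hcd/Hst; rewrite mem_cat xt orbT.
have [pab|pab] := boolP (a < p < b); last exact: Hsub.
have [m1 h1] : exists m : R, forall x, a <= x <= p -> f x = f a + m * (x - a).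
  by apply: Hsub; lra.
have [m2 h2] : exists m : R, forall x, p <= x <= b -> f x = f p + m * (x - p).
  by apply: Hsub; lra.
have dp : derivable f p 1 by apply: dt; [rewrite inE eqxx|lra].
have fp := h1 p ltac:(by lra).
have e1 : derive1 f p = m1.
  apply: (@derive1_left _ _ a) => //; first by lra.
  by move=> y hy; rewrite h1// fp; ring.
have e2 : derive1 f p = m2 by apply: (@derive1_right _ _ b) => //; lra.
exists m1 => x xab.
have [xp|px] := leP x p; first by apply: h1; lra.
by rewrite h2; [rewrite fp -e2 e1; ring|lra].
Qed.

Lemma pow2_gt0 (k : int) : 0 < (2 : R) ^ k.
Proof. exact: exprz_gt0. Qed.

Lemma core_of_thompson f : is_thompson f -> thompson_core f.
Proof.
case=> off cont bij [s pl] brk slp.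
have pl' a b : 0 <= a -> a < b -> b <= 1 ->
    {in s, forall x, ~~ (a < x < b)} ->
    exists m : R, forall x, a <= x <= b -> f x = f a + m * (x - a).
  move=> a0 ab b1 /(pl a b a0 ab b1)[m [c H]]; exists m => x xab.
  rewrite !H; first by ring.
  - by rewrite in_itv /=; lra.
  - by rewrite in_itv /=; lra.
have dp : dyadic_pieces f.
  pose s1 := [seq x <- s | `[< dyadic x >]].
  pose s2 := [seq x <- s | ~~ `[< dyadic x >]].
  exists s1; split; first by move=> x; rewrite mem_filter => /andP[/asboolP].
  move=> a b a0 ab b1 Hs.
  have [m Hm] : exists m : R, forall x, a <= x <= b -> f x = f a + m * (x - a).
    apply: (@pieces_filter f s1 s2 _ _ a b) => //.
      move=> a' b' a0' ab' b1' Hs'; apply: pl' => // x xs; apply: Hs'.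
      by rewrite mem_cat !mem_filter xs !andbT orbN.
    move=> x; rewrite mem_filter => /andP[/asboolP xd _] x01.
    by apply: contrapT => nd; apply: xd; exact: brk.
  have := @affine_is_derive f a b ((a + b) / 2) m.
  case; [by lra|exact: Hm|].
  move=> df dE; have [k Hk] := slp ((a + b) / 2) ltac:(by lra) df.
  by exists k => x xab; rewrite Hm// -dE -derive1E Hk.
have inj : {in `[0, 1] &, injective f}.
  by move=> x y x01 y01; apply: (set_bij_inj bij); rewrite inE.
have mon : {in `[0, 1] &, {mono f : x y / x <= y}}.
  apply: itv_continuous_inj_le => //.
  have [s' [_ Hs']] := dp.
  have [a [b [a0 ax xb b1 Hab]]] := @near_points s' (2^-1) ltac:(by lra).
  have [] := Hs' a 2^-1 a0 ax; first by lra.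
    by move=> y /Hab h; apply/negP => ay; have := h ltac:(by lra); lra.
  move=> k Hk; exists a, 2^-1; rewrite !in_itv /=; split; [lra|lra|done|].
  rewrite [X in _ <= X]Hk; last by lra.
  by rewrite lerDl mulr_ge0 ?ltW ?pow2_gt0 ?subr_gt0.
have f01 x : x \in `[0, 1] -> f x \in `[0, 1].
  exact: (set_bij_homo bij).
have sur y : exists x, f x = y.
  have [y01|y01] := boolP (y \in `[0, 1]); last by exists y; exact: off.
  by have [x _ <-] := set_bij_surj bij y01; exists x.
split => // x y.
have [x01|x01] := boolP (x \in `[0, 1]); have [y01|y01] := boolP (y \in `[0, 1]).
- exact: mon.
- rewrite (off y y01); have := f01 x x01.
  move: x01 y01; rewrite !in_itv /= => h1 h2 h3.
  by apply/idP/idP; move: h1 h2 h3; lra.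
- rewrite (off x x01); have := f01 y y01.
  move: x01 y01; rewrite !in_itv /= => h1 h2 h3.
  by apply/idP/idP; move: h1 h2 h3; lra.
- by rewrite !off.
Qed.

Section Core.
Variables (f : R -> R) (Hf : thompson_core f).

Lemma core_inj : injective f.
Proof. exact: (inc_inj (core_mono Hf)). Qed.

Lemma core_lt : {mono f : x y / x < y}.
Proof. exact: (leW_mono (core_mono Hf)). Qed.

Lemma core01 x : (f x \in `[0, 1]) = (x \in `[0, 1]).
Proof.
apply/idP/idP => h; apply: contraT => nh.
  by move: h; rewrite core_off// (negbTE nh).
by have := core_off Hf nh => /core_inj e; rewrite e h in nh.
Qed.

Lemma core0 : f 0 = 0.
Proof.
have [x fx] := core_surj Hf 0.
have : x \in `[0, 1] by rewrite -core01 fx in_itv /= lexx ler01.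
have : f 0 \in `[0, 1] by rewrite core01 in_itv /= lexx ler01.
rewrite !in_itv /= => /andP[h0 _] /andP[x0 _].
by apply/eqP; rewrite eq_le h0 andbT -[X in _ <= X]fx (core_mono Hf).
Qed.

Lemma core1 : f 1 = 1.
Proof.
have [x fx] := core_surj Hf 1.
have : x \in `[0, 1] by rewrite -core01 fx in_itv /= lexx ler01.
have : f 1 \in `[0, 1] by rewrite core01 in_itv /= lexx ler01.
rewrite !in_itv /= => /andP[_ h0] /andP[_ x0].
by apply/eqP; rewrite eq_le h0 /= -[X in X <= _]fx (core_mono Hf).
Qed.

End Core.

Lemma is_thompson_of_core f : thompson_core f -> is_thompson f.
Proof.
move=> Hf; have [off mon sur [s [ds ps]]] := Hf.
have surj01 : set_surj `[0, 1] `[0, 1] f.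
  move=> y y01; have [x fx] := sur y; exists x => //.
  by rewrite set01E -(core01 Hf) fx.
split => //.
- apply: segment_inc_surj_continuous; first by move=> x y _ _; exact: mon.
  by rewrite (core0 Hf) (core1 Hf).
- split => //; last by move=> x y _ _; exact: core_inj.
  by move=> x; rewrite !set01E (core01 Hf).
- exists s => a b a0 ab b1 /(ps a b a0 ab b1)[k H].
  exists (2 ^ k), (f a - 2 ^ k * a) => x; rewrite in_itv /= => xab.
  by rewrite H//; ring.
- move=> x x01 nd; apply: contrapT => ndx; apply: nd.
  have [a [b [a0 ax xb b1 H]]] := near_points s x01.
  have [] := ps a b a0 (lt_trans ax xb) b1.
    move=> y ys; apply/negP => /(H y ys) yx; apply: ndx.
    by rewrite -yx; exact: ds.
  move=> k /affine_is_derive /= /(_ x); rewrite ax xb => /(_ isT).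
  by case.
- move=> x x01 dfx.
  have [a [b [a0 ax xb b1 H]]] := near_points s x01.
  have [] := ps x b _ xb b1; first by lra.
    move=> y ys; apply/negP => xyb; have : y = x by apply: H => //; lra.
    by move=> yx; lra.
  by move=> k Hk; exists k; apply: (@derive1_right _ _ b).
Qed.

Lemma is_thompsonP f : is_thompson f <-> thompson_core f.
Proof. by split; [exact: core_of_thompson|exact: is_thompson_of_core]. Qed.

Lemma dyadic0 : dyadic 0.
Proof. by exists 0, 0%N; rewrite mul0r. Qed.

Lemma dyadicD x y : dyadic x -> dyadic y -> dyadic (x + y).
Proof.
move=> [m [n ->]] [m' [n' ->]].
exists (m * 2 ^+ n' + m' * 2 ^+ n), (n + n')%N.
rewrite exprD rmorphD /= !rmorphM /= !rmorphXn /=.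
have h k : (2 : R) ^+ k != 0 by rewrite expf_neq0.
by field; rewrite !h.
Qed.

Lemma dyadicN x : dyadic x -> dyadic (- x).
Proof. by move=> [m [n ->]]; exists (- m), n; rewrite rmorphN /= mulNr. Qed.

Lemma dyadicZ (k : int) x : dyadic x -> dyadic (2 ^ k * x).
Proof.
move=> [m [n ->]]; case: k => k.
  exists (2 ^+ k * m), n; rewrite rmorphM /= rmorphXn /= -exprnP.
  by rewrite mulrA.
exists m, (k.+1 + n)%N; rewrite NegzE -exprnN exprD invfM; ring.
Qed.

Lemma dyadicZE (k : int) x : dyadic (2 ^ k * x) <-> dyadic x.
Proof.
split; last exact: dyadicZ.
move=> /(dyadicZ (- k)); rewrite mulrA -expfzDr ?addNr ?mul1r//.
Qed.

Lemma dyadicDl x y : dyadic x -> (dyadic (x + y) <-> dyadic y).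
Proof.
move=> dx; split; last exact: dyadicD.
by move=> /(dyadicD (dyadicN dx)); rewrite addKr.
Qed.

Lemma core_dyadic f x : thompson_core f -> (dyadic (f x) <-> dyadic x).
Proof.
move=> Hf; have [x01|x01] := boolP (x \in `[0, 1]); last by rewrite core_off.
have [s [ds ps]] := core_pieces Hf.
have [n] := ubnP (count (fun y => 0 < y < x) s).
elim: n x x01 => // n IH x x01 hn.
have : 0 <= x by move: x01; rewrite in_itv /= => /andP[].
rewrite le_eqVlt => /orP[/eqP <-|x0]; first by rewrite core0.
have x1 : x <= 1 by move: x01; rewrite in_itv /= => /andP[].
have key p : 0 <= p -> p < x -> dyadic p -> dyadic (f p) ->
    {in s, forall y, ~~ (p < y < x)} -> (dyadic (f x) <-> dyadic x).
  move=> p0 px dp dfp Hs; have [k Hk] := ps p x p0 px x1 Hs.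
  rewrite Hk; last by rewrite ltW //= lexx.
  split.
    move=> /(dyadicDl _ dfp)/dyadicZE; rewrite addrC.
    by move=> /(dyadicDl _ (dyadicN dp)).
  move=> dx; apply/(dyadicDl _ dfp)/dyadicZE.
  by apply: dyadicD => //; exact: dyadicN.
pose t := [seq y <- s | 0 < y < x].
have [t0|] := eqVneq t [::].
  apply: (key 0) => //; [exact: dyadic0|rewrite core0//; exact: dyadic0|].
  move=> y ys; apply/negP => y0x.
  have : y \in t by rewrite mem_filter y0x.
  by rewrite t0.
move=> tn0.
have [p pt pmax] : exists2 p, p \in t & {in t, forall y, y <= p}.
  elim: (t) tn0 => // y t' IHt _.
  have [->|/IHt[p pt' hp]] := eqVneq t' [::].
    by exists y; rewrite ?inE// => z; rewrite inE => /eqP ->.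
  have [yp|py] := leP y p.
    exists p; first by rewrite inE pt' orbT.
    by move=> z; rewrite inE => /orP[/eqP ->//|/hp].
  exists y; first by rewrite inE eqxx.
  move=> z; rewrite inE => /orP[/eqP ->//|/hp zp].
  exact: le_trans zp (ltW py).
move: (pt); rewrite mem_filter => /andP[/andP[p0 px] ps'].
apply: (key p) => //; [exact: ltW|exact: ds| |].
  apply/IH; last exact: ds.
    by rewrite in_itv /= ltW //= (le_trans (ltW px)).
  rewrite (leq_trans _ (hn : (_ <= n)%N))//.
  rewrite -!size_filter -/t.
  have -> : [seq y <- s | 0 < y < p] = [seq y <- t | y < p].
    rewrite /t -filter_predI; apply: eq_filter => y /=.
    by apply/idP/idP; move: px; lra.
  rewrite size_filter -(count_predC (fun y => y < p) t) -addn1 leq_add2l.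
  by rewrite -has_count; apply/hasP; exists p => //=; rewrite ltxx.
move=> y ys; apply/negP => /andP[py yx].
have /pmax : y \in t by rewrite mem_filter ys yx (lt_trans p0 py).
by rewrite leNgt py.
Qed.

Lemma core_id : thompson_core id.
Proof.
split => //; first by move=> y; exists y.
exists [::]; split => // a b _ _ _ _; exists 0 => x _.
by rewrite expr0z mul1r addrC subrK.
Qed.

Lemma core_comp f g : thompson_core f -> thompson_core g ->
  thompson_core (f \o g).
Proof.
move=> Hf Hg; split.
- by move=> x x01 /=; rewrite (core_off Hg)// (core_off Hf).
- by move=> x y /=; rewrite (core_mono Hf) (core_mono Hg).
- move=> z; have [y <-] := core_surj Hf z; have [x <-] := core_surj Hg y.
  by exists x.
have [s [ds ps]] := core_pieces Hf; have [t [dt pt]] := core_pieces Hg.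
pose h y := xget 0 [set x | g x = y].
have hK y : g (h y) = y.
  by rewrite /h; case: xgetP => // /(_ _)/=; have [x gx] := core_surj Hg y;
     move=> /(_ x).
exists (t ++ [seq h y | y <- s]); split.
  move=> x; rewrite mem_cat => /orP[/dt//|/mapP[y ys ->]].
  by apply/(core_dyadic _ Hg); rewrite hK; exact: ds.
move=> a b a0 ab b1 Hst.
have [k Hk] := pt a b a0 ab b1 (fun x xt => Hst x ltac:(by rewrite mem_cat xt)).
have ga0 : 0 <= g a by rewrite -(core0 Hg) (core_mono Hg).
have gb1 : g b <= 1 by rewrite -(core1 Hg) (core_mono Hg).
have gab : g a < g b by rewrite (core_lt Hg).
have [] := ps (g a) (g b) ga0 gab gb1.
  move=> y ys; rewrite -{1 2}(hK y) !(core_lt Hg); apply: Hst.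
  by rewrite mem_cat map_f ?orbT.
move=> l Hl; exists (l + k) => x xab /=.
rewrite Hl; last by rewrite !(core_mono Hg).
rewrite (Hk x xab) [g a + _ - _]addrC addKr.
by rewrite expfzDr// mulrA.
Qed.

Lemma core_inv f h : thompson_core f -> cancel h f -> thompson_core h.
Proof.
move=> Hf hK.
have fK : cancel f h by move=> x; apply: (core_inj Hf); rewrite hK.
have mon : {mono h : x y / x <= y}.
  by move=> x y; rewrite -(core_mono Hf) !hK.
have lt := leW_mono mon.
have h01 x : (h x \in `[0, 1]) = (x \in `[0, 1]) by rewrite -(core01 Hf) hK.
split => //.
- by move=> x x01; apply: (core_inj Hf); rewrite hK (core_off Hf).
- by move=> y; exists (f y).
have [s [ds ps]] := core_pieces Hf.
exists [seq f x | x <- s]; split.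
  by move=> _ /mapP[x xs ->]; apply/(core_dyadic _ Hf); exact: ds.
move=> a b a0 ab b1 Hs.
have h0 : h 0 = 0 by apply: (core_inj Hf); rewrite hK core0.
have h1 : h 1 = 1 by apply: (core_inj Hf); rewrite hK core1.
have [] := ps (h a) (h b).
- by rewrite -h0 mon.
- by rewrite lt.
- by rewrite -h1 mon.
- by move=> x xs; rewrite -[x]fK !lt; apply: Hs; exact: map_f.
move=> k Hk; exists (- k) => x xab.
have -> : x - a = 2 ^ k * (h x - h a).
  by have := Hk (h x); rewrite !mon !hK => /(_ xab) {1}->; rewrite addrC addKr.
by rewrite mulrA -expfzDr ?addNr// mul1r addrC subrK.
Qed.

End ThompsonPredicate.

Record thompsonF (R : realType) := ThompsonF {
  thompson_fun :> R -> R;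
  thompson_funP : is_thompson thompson_fun }.

Section ThompsonGroup.
Variable R : realType.
Implicit Types f g : thompsonF R.

HB.instance Definition _ := gen_eqMixin (thompsonF R).
HB.instance Definition _ := gen_choiceMixin (thompsonF R).

Lemma thompsonF_eqP f g : f =1 g -> f = g.
Proof.
case: f g => [f Hf] [g Hg] /= /funext fg; rewrite fg in Hf *.
by congr ThompsonF; exact: Prop_irrelevance.
Qed.

Lemma thompsonF_core f : thompson_core f.
Proof. by apply/is_thompsonP; exact: thompson_funP. Qed.

Definition thompson_one : thompsonF R :=
  ThompsonF (is_thompson_of_core (core_id R)).

Definition thompson_mul f g : thompsonF R :=
  ThompsonF (is_thompson_of_core
    (core_comp (thompsonF_core f) (thompsonF_core g))).

Definition thompson_inv_fun f (y : R) : R := xget 0 [set x | f x = y].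

Lemma thompson_inv_funK f : cancel (thompson_inv_fun f) f.
Proof.
move=> y; rewrite /thompson_inv_fun; case: xgetP => // H.
by have [x fx] := core_surj (thompsonF_core f) y; case: (H x).
Qed.

Definition thompson_inv f : thompsonF R :=
  ThompsonF (is_thompson_of_core
    (core_inv (thompsonF_core f) (@thompson_inv_funK f))).

Lemma thompson_mulA : associative thompson_mul.
Proof. by move=> f g h; exact: thompsonF_eqP. Qed.

Lemma thompson_mul1 : left_id thompson_one thompson_mul.
Proof. by move=> f; exact: thompsonF_eqP. Qed.

Lemma thompson_mulr1 : right_id thompson_one thompson_mul.
Proof. by move=> f; exact: thompsonF_eqP. Qed.

Lemma thompson_mulrV : right_inverse thompson_one thompson_inv thompson_mul.
Proof. by move=> f; apply: thompsonF_eqP => x /=; exact: thompson_inv_funK. Qed.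

Lemma thompson_mulVr : left_inverse thompson_one thompson_inv thompson_mul.
Proof.
move=> f; apply: thompsonF_eqP => x /=.
by apply: (core_inj (thompsonF_core f)); exact: thompson_inv_funK.
Qed.

HB.instance Definition _ := isGroup.Build (thompsonF R)
  thompson_mulA thompson_mul1 thompson_mulr1 thompson_mulVr thompson_mulrV.

End ThompsonGroup.

Section Liouville.
Variables (R : realType) (G : groupType).
Implicit Types (mu f : G -> R).

(* \sum_(h \in A) is the sum over the support of the summand, which is finite
   wherever it is used below. *)
Record finitely_supported_probability mu : Prop := {
  mu_ge0 : forall h, 0 <= mu h;
  mu_finite : finite_set [set h | mu h != 0];
  mu_sum1 : \sum_(h \in [set: G]) mu h = 1 }.

Definition symmetric_measure mu : Prop := forall h, mu (h^-1)%g = mu h.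

Definition harmonic_fun mu f : Prop :=
  forall g, f g = \sum_(h \in [set: G]) mu h * f (g * h)%g.

(* The states visited with positive probability by the right random walk
   started at the identity. *)
Definition reachable mu : set G :=
  [set g | exists2 s : seq G,
    {in s, forall h, 0 < mu h} & g = (\prod_(h <- s) h)%g].

(* The walk is started at the identity, so its Poisson boundary only sees the
   restriction of harmonic functions to the reachable states.  When the support
   of mu generates G these are all of G; otherwise mu has non-constant bounded
   harmonic functions on G merely because distinct cosets of the generated
   subgroup do not communicate (for the point mass at the identity every
   function is harmonic), although the Poisson boundary may be trivial. *)
Definition liouville_pair mu : Prop :=
  forall f, bounded_fun f -> harmonic_fun mu f ->
    exists c : R, forall g, reachable mu g -> f g = c.

Definition liouville : Prop :=
  forall mu, finitely_supported_probability mu -> symmetric_measure mu ->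
    liouville_pair mu.

End Liouville.

(* Main.v *)
Require Import Defs.
From mathcomp Require Import all_boot all_order all_algebra.
From mathcomp Require Import all_classical all_reals all_analysis.
From mathcomp Require Import ring lra zify.

Set Implicit Arguments.
Unset Strict Implicit.
Unset Printing Implicit Defensive.

Import Order.TTheory GRing.Theory Num.Theory.
Import numFieldNormedType.Exports.

Local Open Scope classical_set_scope.
Local Open Scope ring_scope.

(* The boundary of (F, mu), with mu uniform on two generators and their
   inverses, is detected on the orbit of 1/2.  The two generators act on
   [1/4, 3/4] by x |-> x/2 + 1/8 and x |-> x/2 + 3/8, so that the dyadic numbers
   of ]1/4, 3/4[ form a binary tree rooted at 1/2 whose other Schreier edges
   lead into rays ("hairs") x |-> x/2 near 0 and x |-> (x + 1)/2 near 1.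
   A function that is constant on every hair and equal to +-(1 - 2^-n) at
   depth n of the tree, the sign telling the two subtrees of the root apart, is
   harmonic: at a vertex of depth n > 0 with value h > 0 the four neighbours have
   values 2h - 1 (parent), (h + 1)/2 twice (children) and h (hair).  Pulled back
   by g |-> g^-1 (1/2), it is a bounded non-constant harmonic function on F. *)

(** * Uniform measures on lists of group elements *)

Section SequenceMeasure.
Variables (R : realType) (G : groupType).
Implicit Types (s : seq G) (f : G -> R).

(** Counting with multiplicity turns integrals against the measure into plain averages over the
    list, whether or not entries repeat. *)
Definition seq_measure s (h : G) : R := (count_mem h s)%:R / (size s)%:R.

Lemma seq_measure_sum s f :
  \sum_(h \in [set: G]) seq_measure s h * f h =
  (\sum_(h <- s) f h) / (size s)%:R.
Proof.
rewrite (fsbigE (undup s)) ?undup_uniq//; last first.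
  move=> h _; rewrite mem_undup => hs.
  by rewrite /seq_measure (count_memPn hs) !mul0r.
under eq_bigl do rewrite in_setT.
rewrite -(big_undup_iterop_count _ s predT f) mulr_suml.
apply: eq_bigr => h _.
rewrite -[iterop _ _ _ _]/(f h *+ _) -[f h *+ _]mulr_natl.
by rewrite /seq_measure mulrAC.
Qed.

Lemma seq_measure_probability s : (0 < size s)%N ->
  finitely_supported_probability (seq_measure s).
Proof.
move=> s0; split=> [h||]; first by rewrite divr_ge0.
- apply: (@sub_finite_set _ _ [set` s]) => [h /=|]; last exact: finite_seq.
  by apply: contraNT => hs; rewrite /seq_measure (count_memPn hs) mul0r.
(* The total mass is the average of the constant function 1. *)
- under eq_fsbigr do rewrite -[seq_measure _ _]mulr1.
  by rewrite seq_measure_sum big_const_seq count_predT iter_addr_0 divff// pnatr_eq0 -lt0n.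
Qed.

Lemma seq_measure_gt0 s h : h \in s -> 0 < seq_measure s h.
Proof.
move=> hs; have hs0 : (0 < count_mem h s)%N by rewrite -has_count has_pred1.
by rewrite divr_gt0// ltr0n// (leq_trans hs0)// count_size.
Qed.

End SequenceMeasure.

(** * The tree function on the dyadic numbers of ]0, 1[ *)

Section TreeFunction.
Variable R : realType.
Implicit Types x h : R.

(** Away from 1/2, this inverts the two contractions on ]1/4, 3/4[; elsewhere it moves one step
    along a hair towards the tree. The value at the root 1/2 is a dummy, which [extend] ignores. *)
Definition parent x : R :=
  if x <= 1 / 4 then 2 * x else if x < 1 / 2 then 2 * x - 1 / 4
  else if x < 3 / 4 then 2 * x - 3 / 4 else 2 * x - 1.

(* The value at x that makes the function harmonic, given its value h at the
   parent of x. *)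
Definition extend x h : R :=
  if (x <= 1 / 4) || (3 / 4 <= x) then h else if x == 1 / 2 then 0
  else (h + Num.sg (if parent x == 1 / 2 then x - 1 / 2 else h)) / 2.

(* The argument n is fuel: parent strictly lowers the level, see has_level. *)
Fixpoint tree_fun_rec n x : R :=
  if n is n'.+1 then extend x (tree_fun_rec n' (parent x)) else 0.

(** The offset 2 makes level 0 the multiples of 1/4, so that the value 0 returned without fuel is
    correct there. *)
Definition has_level x n : Prop := 2 ^+ n.+2 * x \is a Num.int.

(** Each branch of [parent] is 2x - y with y a multiple of 1/4: doubling lowers the level, and
    subtracting y preserves it. *)
Lemma has_level_parent n x : has_level x n.+1 -> has_level (parent x) n.
Proof.
have key y : 2 ^+ n.+2 * y \is a Num.int ->
    has_level x n.+1 -> has_level (2 * x - y) n.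
  by rewrite /has_level => y_int x_int; rewrite mulrBr mulrA -exprSr rpredB.
have quarter (k : nat) : 2 ^+ n.+2 * (k%:R / 4) \is a @Num.int R.
  rewrite (_ : _ * _ = 2 ^+ n * k%:R); last by rewrite !exprS; field.
  by rewrite rpredM// ?rpredX// natr_int.
rewrite /parent => x_int.
case: ifP => _; first by rewrite -[2 * x]subr0; apply: key; rewrite // mulr0.
case: ifP => _; first exact: (key _ (quarter 1)).
case: ifP => _; first exact: (key _ (quarter 3)).
by apply: key x_int; rewrite mulr1 rpredX// natr_int.
Qed.

Lemma parent_itv x : 0 < x < 1 -> 0 < parent x < 1.
Proof. by move=> x01; rewrite /parent; do !case: ifP => ?; lra. Qed.

(** Only 1/4, 1/2 and 3/4 qualify: the outer two lie on hairs and copy the value 0, and 1/2 is the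
    root. *)
Lemma has_level0 x : 0 < x < 1 -> has_level x 0 -> extend x 0 = 0.
Proof.
move=> x01 /intrP[m xE]; rewrite /extend.
have {}xE : x = m%:~R / 4 by rewrite -xE; field.
case: ifP => // H; have /andP[m1 m3] : (1%:~R < m%:~R :> R) && (m%:~R < 3%:~R :> R).
  by rewrite xE in H x01; move: H; lra.
rewrite !ltr_int in m1 m3.
have m2 : m = 2 by lia.
by rewrite xE m2 ifT//; apply/eqP; field.
Qed.

(** Extra fuel only adds a call at a point of level 0, where [has_level0] gives back the value 0. *)
Lemma tree_fun_recS n x : 0 < x < 1 -> has_level x n ->
  tree_fun_rec n.+1 x = tree_fun_rec n x.
Proof.
elim: n x => [|n IH] x x01 xn; first exact: has_level0.
rewrite -[LHS]/(extend x (tree_fun_rec n.+1 (parent x))) IH//.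
- exact: parent_itv.
- exact: has_level_parent.
Qed.

Lemma tree_fun_rec_le n m x : (n <= m)%N -> 0 < x < 1 -> has_level x n ->
  tree_fun_rec m x = tree_fun_rec n x.
Proof.
move=> /subnKC <- x01 xn; elim: (m - n)%N => [|k IH]; first by rewrite addn0.
rewrite addnS tree_fun_recS//.
rewrite /has_level -addSn -addSn addnC exprD -mulrA.
by apply: rpredM => //; rewrite rpredX// natr_int.
Qed.

(** Any level may be chosen as fuel, by [tree_funE]; a point without a level gets fuel 0, hence
    value 0. *)
Definition tree_fun x : R := tree_fun_rec (xget 0%N (has_level x)) x.

Lemma dyadic_has_level x : dyadic x -> exists n, has_level x n.
Proof.
move=> [m [n ->]]; exists n; rewrite /has_level 2!exprS mulrA mulrA.
rewrite (_ : _ / _ = 4 * m%:~R); last by field; rewrite expf_neq0.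
by rewrite rpredM// ?natr_int ?intr_int.
Qed.

Lemma tree_funE n x : 0 < x < 1 -> has_level x n ->
  tree_fun x = tree_fun_rec n x.
Proof.
move=> x01 xn; rewrite /tree_fun; case: xgetP => [k _ xk|/(_ n)//].
have [nk|/ltnW kn] := leqP n k; first exact: tree_fun_rec_le.
by rewrite [RHS](tree_fun_rec_le kn).
Qed.

Lemma tree_fun_step x : 0 < x < 1 -> dyadic x ->
  tree_fun x = extend x (tree_fun (parent x)).
Proof.
move=> x01 /dyadic_has_level[n xn].
(* Raising the level by one lets the recursion unfold once even when n = 0. *)
have xn1 : has_level x n.+1 by rewrite /has_level exprS -mulrA rpredM// natr_int.
rewrite (tree_funE x01 xn1) (tree_funE (parent_itv x01) (has_level_parent xn1)).
by [].
Qed.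

(** Each step copies the value, resets it to 0 or averages it with a sign, and so stays within
    [-1, 1]. *)
Lemma tree_fun_bound x : `|tree_fun x| <= 1.
Proof.
rewrite /tree_fun; move: (xget _ _) => n; elim: n x => [|n IH] x /=.
  by rewrite normr0.
rewrite /extend; case: ifP => // _; case: ifP => _; first by rewrite normr0.
rewrite normrM [`|2^-1|]ger0_norm ?invr_ge0//.
have sg1 (y : R) : `|Num.sg y| <= 1 by rewrite normr_sg lern1 leq_b1.
have := ler_normD (tree_fun_rec n (parent x))
  (Num.sg (if parent x == 1 / 2 then x - 1 / 2 else tree_fun_rec n (parent x))).
have := IH (parent x); have := sg1 (if parent x == 1 / 2 then x - 1 / 2 else
  tree_fun_rec n (parent x)).
lra.
Qed.

Lemma tree_fun_left x : 0 < x <= 1 / 4 -> dyadic x ->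
  tree_fun x = tree_fun (2 * x).
Proof.
move=> x0 dx; rewrite tree_fun_step//; last by lra.
by rewrite /extend /parent; case/andP: x0 => _ ->.
Qed.

Lemma tree_fun_right x : 3 / 4 <= x < 1 -> dyadic x ->
  tree_fun x = tree_fun (2 * x - 1).
Proof.
move=> x1 dx; rewrite tree_fun_step//; last by lra.
by rewrite /extend /parent ifT ?ifF //; lra.
Qed.

Lemma tree_fun_root : tree_fun (1 / 2) = 0.
Proof.
rewrite tree_fun_step; last first.
- by exists 1, 1%N.
- by lra.
by rewrite /extend ifF ?eqxx//; lra.
Qed.

Lemma tree_fun_inner x : 1 / 4 < x < 3 / 4 -> x != 1 / 2 -> dyadic x ->
  tree_fun x = (tree_fun (parent x) +
    Num.sg (if parent x == 1 / 2 then x - 1 / 2 else tree_fun (parent x))) / 2.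
Proof.
move=> x_in /negbTE x_root dx; rewrite {1}tree_fun_step//; last by lra.
by rewrite /extend x_root ifF//; lra.
Qed.

(** Averaging with its own sign preserves the sign of a value, so the recursion can be solved for
    the parent; at a child of the root, +-1/2 gives back 0. *)
Lemma tree_fun_parent x : 1 / 4 < x < 3 / 4 -> x != 1 / 2 -> dyadic x ->
  tree_fun (parent x) = 2 * tree_fun x - Num.sg (tree_fun x).
Proof.
move=> x_in x_root dx; rewrite (tree_fun_inner x_in x_root dx).
case: eqP => [->|_]; last first.
  by case: (sgrP (tree_fun (parent x))) => [->|?|?]; case: sgrP => ?; lra.
rewrite tree_fun_root; have : x - 1 / 2 != 0 by rewrite subr_eq0.
by case: (sgrP (x - 1 / 2)) => // _ _; case: sgrP => ?; lra.
Qed.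

Lemma tree_fun_child x y : 1 / 4 < x < 3 / 4 -> x != 1 / 2 -> dyadic x ->
  1 / 4 < y < 3 / 4 -> y != 1 / 2 -> dyadic y -> parent y = x ->
  tree_fun y = (tree_fun x + Num.sg (tree_fun x)) / 2.
Proof.
move=> x_in x_root dx y_in y_root dy yx.
by rewrite (tree_fun_inner y_in y_root dy) yx (negbTE x_root).
Qed.

Lemma tree_fun_root_child y : 1 / 4 < y < 3 / 4 -> y != 1 / 2 -> dyadic y ->
  parent y = 1 / 2 -> tree_fun y = Num.sg (y - 1 / 2) / 2.
Proof.
move=> y_in y_root dy yx.
by rewrite (tree_fun_inner y_in y_root dy) yx eqxx tree_fun_root add0r.
Qed.

End TreeFunction.

(** * The two generators and their action on the tree and its hairs *)

Section Generators.
Variable R : realType.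
Implicit Types (x y : R) (f : R -> R).

(** Besides contracting [1/4, 3/4] to its left half, it fixes the hairs at 0 and moves those at 1
    one step towards the tree. *)
Definition squeeze_left x : R :=
  if x <= 1 / 4 then x else if x <= 3 / 4 then x / 2 + 1 / 8
  else if x <= 1 then 2 * x - 1 else x.

Lemma squeeze_left_low x : x <= 1 / 4 -> squeeze_left x = x.
Proof. by rewrite /squeeze_left => ->. Qed.

Lemma squeeze_left_mid x : 1 / 4 <= x <= 3 / 4 ->
  squeeze_left x = x / 2 + 1 / 8.
Proof. by move=> x_in; rewrite /squeeze_left; do !case: ifP => ?; lra. Qed.

Lemma squeeze_left_high x : 3 / 4 <= x <= 1 -> squeeze_left x = 2 * x - 1.
Proof. by move=> x_in; rewrite /squeeze_left; do !case: ifP => ?; lra. Qed.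

Lemma squeeze_left_core : thompson_core squeeze_left.
Proof.
split.
- move=> x; rewrite in_itv /= /squeeze_left => x01.
  by do !case: ifP => ?; lra.
- apply: le_mono => x y xy; rewrite /squeeze_left.
  by do !case: ifP => ?; lra.
- move=> y; rewrite /squeeze_left.
  have [?|?] := leP y (1 / 4); first by exists y; do !case: ifP => ?; lra.
  have [?|?] := leP y (1 / 2).
    by exists (2 * y - 1 / 4); do !case: ifP => ?; lra.
  have [?|?] := leP y 1; first by exists ((y + 1) / 2); do !case: ifP => ?; lra.
  by exists y; do !case: ifP => ?; lra.
exists [:: 1 / 4; 3 / 4]; split=> [x|a b a0 ab b1 breaks].
  by rewrite !inE => /orP[]/eqP->; [exists 1, 2%N|exists 3, 2%N]; rewrite expr2; field.
have b14 : ~~ (a < 1 / 4 < b) by apply: breaks; rewrite !inE eqxx.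
have b34 : ~~ (a < 3 / 4 < b) by apply: breaks; rewrite !inE eqxx orbT.
(* An interval avoiding both breakpoints lies in a single piece, of slope 1, 1/2 or 2. *)
have [ba|ba] := leP b (1 / 4); last have [bc|bc] := leP b (3 / 4).
- exists 0 => x x_in; rewrite expr0z !squeeze_left_low; lra.
- exists (-1) => x x_in; rewrite exprN1 !squeeze_left_mid; lra.
- exists 1 => x x_in; rewrite expr1z !squeeze_left_high; lra.
Qed.

(** Conjugation by x |-> 1 - x preserves slopes and dyadic breakpoints; it produces the second
    generator from the first. *)
Lemma reflect_core f : thompson_core f -> thompson_core (fun x => 1 - f (1 - x)).
Proof.
move=> Hf; split.
- move=> x; rewrite in_itv /= => x01; rewrite (core_off Hf); first by ring.
  by rewrite in_itv /=; lra.
- by move=> x y; rewrite lerD2l lerN2 (core_mono Hf) lerD2l lerN2.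
- move=> y; have [x fx] := core_surj Hf (1 - y); exists (1 - x).
  by rewrite (_ : 1 - (1 - x) = x) ?fx; ring.
have [s [ds ps]] := core_pieces Hf.
exists [seq 1 - x | x <- s]; split.
  move=> _ /mapP[x xs ->]; apply: dyadicD; last exact/dyadicN/ds.
  by exists 1, 0%N; rewrite divr1.
move=> a b a0 ab b1 breaks.
have [|||x xs|k fE] := ps (1 - b) (1 - a); [lra|lra|lra| |].
  by have := breaks (1 - x) (map_f _ xs); lra.
exists k => x x_in; rewrite (fE (1 - x)) ?(fE (1 - a)); [ring|lra|lra].
Qed.

Definition generator_left : thompsonF R :=
  ThompsonF (is_thompson_of_core squeeze_left_core).

Definition generator_right : thompsonF R :=
  ThompsonF (is_thompson_of_core (reflect_core squeeze_left_core)).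

Lemma generator_leftE x : generator_left x = squeeze_left x. Proof. by []. Qed.

Lemma generator_rightE x : generator_right x = 1 - squeeze_left (1 - x).
Proof. by []. Qed.

(** Inverses are defined by choice, so their values are computed by exhibiting a preimage. *)
Lemma thompson_invE (f : thompsonF R) x y : f x = y -> (f^-1)%g y = x.
Proof.
move=> fx; apply: (core_inj (thompsonF_core f)); rewrite fx.
exact: thompson_inv_funK.
Qed.

Lemma thompson_mulE (f g : thompsonF R) x : (f * g)%g x = f (g x).
Proof. by []. Qed.

Ltac piecewise_lra :=
  rewrite /parent ?generator_leftE ?generator_rightE /squeeze_left;
  do !case: ifP => ?; lra.

Lemma tree_fun_generator_left_root : tree_fun (generator_left (1 / 2)) = - (1 / 2).
Proof.
have e : generator_left (1 / 2) = 3 / 8 by piecewise_lra.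
have d : dyadic (generator_left (1 / 2)).
  by apply/(core_dyadic _ (thompsonF_core _)); exists 1, 1%N.
rewrite e in d *; rewrite tree_fun_root_child//; [|lra|lra|piecewise_lra].
by rewrite ltr0_sg; lra.
Qed.

Lemma tree_fun_generator_right_root : tree_fun (generator_right (1 / 2)) = 1 / 2.
Proof.
have e : generator_right (1 / 2) = 5 / 8 by piecewise_lra.
have d : dyadic (generator_right (1 / 2)).
  by apply/(core_dyadic _ (thompsonF_core _)); exists 1, 1%N.
rewrite e in d *; rewrite tree_fun_root_child//; [|lra|lra|piecewise_lra].
by rewrite gtr0_sg; lra.
Qed.

Lemma tree_fun_mean y : 0 < y < 1 -> dyadic y ->
  tree_fun (generator_left y) + tree_fun ((generator_left^-1)%g y) +
  tree_fun (generator_right y) + tree_fun ((generator_right^-1)%g y)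
  = 4 * tree_fun y.
Proof.
move=> y01 dy.
have dyad (f : thompsonF R) : dyadic (f y).
  exact/(core_dyadic _ (thompsonF_core f)).
have dl := dyad generator_left; have dr := dyad generator_right.
have dli := dyad (generator_left^-1)%g; have dri := dyad (generator_right^-1)%g.
(* On a hair at 0 the left generator fixes [y] and the right one moves it along the hair, so all
   four values agree. The next case is its mirror image. *)
have [y_left|y_left] := leP y (1 / 4).
  have le : generator_left y = y by piecewise_lra.
  have re : generator_right y = 2 * y by piecewise_lra.
  have rie : (generator_right^-1)%g y = y / 2.
    by apply: thompson_invE; piecewise_lra.
  rewrite le (thompson_invE le) re -tree_fun_left//; last by lra.
  rewrite rie in dri *; rewrite [tree_fun (y / 2)]tree_fun_left//; last by lra.
  by rewrite (_ : 2 * (y / 2) = y); [ring|field].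
have [y_right|y_right] := leP (3 / 4) y.
  have re : generator_right y = y by piecewise_lra.
  have le : generator_left y = 2 * y - 1 by piecewise_lra.
  have lie : (generator_left^-1)%g y = (y + 1) / 2.
    by apply: thompson_invE; piecewise_lra.
  rewrite re (thompson_invE re) le -tree_fun_right//; last by lra.
  rewrite lie in dli *.
  rewrite [tree_fun ((y + 1) / 2)]tree_fun_right//; last by lra.
  by rewrite (_ : 2 * ((y + 1) / 2) - 1 = y); [ring|field].
(* At the root both inverses enter hairs, of value 0, and the children's values -1/2 and 1/2
   cancel. *)
have [y_root|y_root] := eqVneq y (1 / 2).
  have lie : (generator_left^-1)%g y = 3 / 4.
    by apply: thompson_invE; rewrite y_root; piecewise_lra.
  have rie : (generator_right^-1)%g y = 1 / 4.
    by apply: thompson_invE; rewrite y_root; piecewise_lra.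
  rewrite lie in dli *; rewrite rie in dri *.
  rewrite (tree_fun_right _ dli); last by lra.
  rewrite (tree_fun_left _ dri); last by lra.
  rewrite (_ : 2 * (3 / 4) - 1 = 1 / 2); last by field.
  rewrite (_ : 2 * (1 / 4) = 1 / 2); last by field.
  rewrite y_root tree_fun_generator_left_root tree_fun_generator_right_root.
  by rewrite tree_fun_root; ring.
have y_in : 1 / 4 < y < 3 / 4 by lra.
have le : generator_left y = y / 2 + 1 / 8 by piecewise_lra.
have re : generator_right y = y / 2 + 3 / 8 by piecewise_lra.
have y_neq : y < 1 / 2 \/ 1 / 2 < y.
  by case: ltgtP y_root => // ?; [left|right].
have -> : tree_fun (generator_left y) = (tree_fun y + Num.sg (tree_fun y)) / 2.
  by apply: tree_fun_child => //; rewrite le; [lra|lra|piecewise_lra].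
have -> : tree_fun (generator_right y) = (tree_fun y + Num.sg (tree_fun y)) / 2.
  by apply: tree_fun_child => //; rewrite re; [lra|lra|piecewise_lra].
have py := tree_fun_parent y_in y_root dy.
(* On the left of 1/2, [generator_left^-1] leads to the parent and [generator_right^-1] to a hair;
   on the right the roles swap. With h the value and s its sign, the sum is (h + s) + (2h - s) + h =
   4h. *)
case: y_neq => y_half.
  have pE : parent y = 2 * y - 1 / 4 by piecewise_lra.
  have lie : (generator_left^-1)%g y = parent y.
    by apply: thompson_invE; rewrite pE; piecewise_lra.
  have rie : (generator_right^-1)%g y = y / 2.
    by apply: thompson_invE; piecewise_lra.
  rewrite lie py; rewrite rie in dri *.
  rewrite [tree_fun (y / 2)]tree_fun_left//; last by lra.
  by rewrite (_ : 2 * (y / 2) = y); field.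
have lie : (generator_left^-1)%g y = (y + 1) / 2.
  by apply: thompson_invE; piecewise_lra.
have pE : parent y = 2 * y - 3 / 4 by piecewise_lra.
have rie : (generator_right^-1)%g y = parent y.
  by apply: thompson_invE; rewrite pE; piecewise_lra.
rewrite rie py; rewrite lie in dli *.
rewrite [tree_fun ((y + 1) / 2)]tree_fun_right//; last by lra.
by rewrite (_ : 2 * ((y + 1) / 2) - 1 = y); field.
Qed.

(** * Transfer from the orbit of 1/2 to the group *)

Lemma orbit_root (f : thompsonF R) : 0 < f (1 / 2) < 1 /\ dyadic (f (1 / 2)).
Proof.
have Hf := thompsonF_core f; split.
  have := core_lt Hf 0 (1 / 2); have := core_lt Hf (1 / 2) 1.
  by rewrite (core0 Hf) (core1 Hf) => -> ->; lra.
by apply/(core_dyadic _ Hf); exists 1, 1%N.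
Qed.

Definition generators : seq (thompsonF R) :=
  [:: generator_left; generator_left^-1; generator_right; generator_right^-1]%g.

Lemma generators_symmetric :
  symmetric_measure (seq_measure R generators).
Proof.
move=> h; rewrite /seq_measure /=; congr (_%:R / _).
have eV (k : thompsonF R) : (k == h^-1)%g = ((k^-1)%g == h).
  by rewrite eqg_invLR.
rewrite !eV (invgK generator_left) (invgK generator_right).
by rewrite addnCA; congr (_ + (_ + _))%N; exact: addnCA.
Qed.

(** The inverse turns the right step g |-> gh into the action of h^-1 on the current point g^-1
    (1/2). *)
Definition orbit_fun (g : thompsonF R) : R := tree_fun ((g^-1)%g (1 / 2)).

Lemma orbit_fun_harmonic : harmonic_fun (seq_measure R generators) orbit_fun.
Proof.
move=> g; rewrite (seq_measure_sum generators (fun h => orbit_fun (g * h)%g)).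
have [y01 dy] := orbit_root (g^-1)%g.
(* Inverting the steps merely permutes the four terms of [tree_fun_mean]. *)
rewrite !big_cons big_nil addr0 /orbit_fun !invgM !invgK !thompson_mulE /=.
have := tree_fun_mean y01 dy.
lra.
Qed.

Lemma orbit_fun_bounded : bounded_fun orbit_fun.
Proof.
exists 1; split=> [|M M1 g _ /=]; first exact: real1.
by rewrite (le_trans (tree_fun_bound _))// ltW.
Qed.

End Generators.

Theorem theorem2p5 (R : realType) : ~ liouville R (thompsonF R).
Proof.
move=> liou.
have [|c fc] := liou _ (seq_measure_probability R _) (@generators_symmetric R)
  _ (@orbit_fun_bounded R) (@orbit_fun_harmonic R); first by [].
have f1 : orbit_fun (1%g : thompsonF R) = 0.
  by rewrite /orbit_fun invg1; exact: tree_fun_root.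
(* The state reached by the single step [generator_left^-1] corresponds to the left child 3/8 of the
   root, whose value differs from that at the identity. *)
have fl : orbit_fun (generator_left R)^-1%g = - (1 / 2).
  by rewrite /orbit_fun invgK; exact: tree_fun_generator_left_root.
have c1 := fc 1%g; have cl := fc ((generator_left R)^-1)%g.
rewrite f1 in c1; rewrite fl in cl.
have e1 : 0 = c by apply: c1; exists [::]; rewrite ?big_nil.
have el : - (1 / 2) = c.
  apply: cl; exists [:: (generator_left R)^-1%g]; last by rewrite big_seq1.
  move=> h; rewrite inE => /eqP ->; apply: seq_measure_gt0.
  by rewrite !inE eqxx orbT.
lra.
Qed.
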